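(* Let $n\ge1$ and $d\ge 0$. If there exists a Gray code $F:\{0,1\}^n\to\{0,1\}^n$ of degree at most $d$, then $d\ge\log_2 n$.
   Context: An automata network is a map $F:\{0,1\}^V\to\{0,1\}^V$, $V=\{1,\dots,n\}$, with local functions $f_j(x)=F(x)_j$. Its interaction graph has an arc $(i,j)$ iff $f_j$ effectively depends on $x_i$ (there exist $x,x'$ differing only at $i$ with $f_j(x)\neq f_j(x')$). The degree of $F$ is the maximum in-degree of its interaction graph. A Gray code is a map $F$ whose functional graph is a single cycle of length $2^n$ and such that, for every $x$, $x$ and $F(x)$ differ in exactly one component. *)

(* Defs.v *)
From mathcomp Require Import all_boot all_algebra.
From mathcomp Require Import reals exp.

Set Implicit Arguments.
Unset Strict Implicit.
Unset Printing Implicit Defensive.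

Import GRing.Theory.

Definition config (n : nat) := {ffun 'I_n -> bool}.

Definition diff_set n (x y : config n) : {set 'I_n} := [set k | x k != y k].

Definition interaction n (F : config n -> config n) : rel 'I_n :=
  fun i j =>
    [exists x, exists x', (diff_set x x' == [set i]) && (F x j != F x' j)].

Definition degree n (F : config n -> config n) : nat :=
  \max_(j < n) #|[set i | interaction F i j]|.

(* The functional graph has an arc from x to F x for every configuration x:
   ufcycle F c says that c is a simple directed cycle of this graph, and the
   last clause that the graph has no vertex outside c. *)
Definition is_gray_code n (F : config n -> config n) : Prop :=
  (exists c : seq (config n),
      [/\ ufcycle F c, size c = 2 ^ n & forall x, x \in c])
  /\ (forall x, #|diff_set x (F x)| = 1).

Definition log2 (R : realType) (x : R) : R := (ln x / ln 2)%R.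

(* Main.v *)
Require Import Defs.
From mathcomp Require Import all_boot all_algebra.
From mathcomp Require Import reals exp.

Import GRing.Theory Num.Theory.

(** The sets [D_j] of configurations at which [F] flips component [j] partition
the hypercube, and each is nonempty because the cycle visits both values of
component [j].  Let [S] be the set of in-neighbours of [j].  If [j] is in [S],
then [D_j] is a union of subcubes fixing only the at most [d] components in
[S]; otherwise [f_j] ignores [x_j] and [D_j] contains exactly one endpoint of
every edge in direction [j].  In both cases [D_j] has density at least [2^-d]
(for [d = 0], [F] would be constant and thus have a fixed point).  Summing over
[j] gives [n <= 2^d]. *)

(** Induction on the number of components where [x] and [y] differ: such an [i] cannot be an
    in-neighbour of [j], so copying [y i] into [x] keeps [F _ j] and removes one difference. *)
Lemma interaction_eq n (F : config n -> config n) (j : 'I_n) (x y : config n) :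
  (forall i, interaction F i j -> x i = y i) -> F x j = F y j.
Proof.
have [m] := ubnP #|diff_set x y|.
elim: m x => // m IHm x ltm eqS.
have [/setP D0|[i]] := set_0Vmem (diff_set x y).
  suff -> : x = y by [].
  apply/ffunP => i; apply/eqP; move: (D0 i).
  by rewrite !inE => /negbT; rewrite negbK.
move=> iD; have xyi : x i != y i by move: iD; rewrite inE.
pose x' : config n := [ffun k => if k == i then y k else x k].
have Dx' : diff_set x' y = diff_set x y :\ i.
  by apply/setP => k; rewrite !inE ffunE; case: (k =P i); rewrite ?eqxx.
have Nij : ~~ interaction F i j.
  by apply: contra xyi => /eqS ->.
transitivity (F x' j).
  apply/eqP/negPn; apply: contra Nij => neF.
  apply/existsP; exists x; apply/existsP; exists x'; rewrite neF andbT.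
  apply/eqP/setP => k; rewrite !inE ffunE.
  by case: (k =P i) => [->|]; rewrite ?eqxx.
apply: IHm => [|k /eqS xyk]; last by rewrite ffunE; case: ifP.
by move: ltm; rewrite Dx' (cardsD1 i (diff_set x y)) iD.
Qed.

(** Otherwise component [j] is constant along orbits, yet the orbit of the all-false configuration
    reaches the all-true one. *)
Lemma gray_cycle_flips n (F : config n -> config n) (c : seq (config n))
    (j : 'I_n) :
  fcycle F c -> (forall x, x \in c) -> exists x, F x j != x j.
Proof.
move=> cycF allc.
have [/existsP //|/existsPn fixj] := boolP [exists x, F x j != x j].
pose x : config n := [ffun=> false]; pose y : config n := [ffun=> true].
have: fconnect F x y by rewrite (fconnect_cycle cycF).
move/iter_findex => itF.
have itj k : iter k F x j = x j.
  by elim: k => //= k <-; apply/eqP; rewrite -[_ == _]negbK fixj.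
by have := itj (findex F x y); rewrite itF !ffunE.
Qed.

(** Overwriting [y] by [x0] on [S] lands in [D], and the erased bits form a subset of [S]; together
    they determine [y]. *)
Lemma subcube_density n (S : {set 'I_n}) (D : {set config n}) (x0 : config n) :
  (forall y : config n, {in S, y =1 x0} -> y \in D) ->
  2 ^ n <= #|D| * 2 ^ #|S|.
Proof.
move=> subD.
pose h (y : config n) : config n * {set 'I_n} :=
  ([ffun k => if k \in S then x0 k else y k], [set k in S | y k]).
have injh : injective h.
  move=> y z [/ffunP eq1 /setP eq2]; apply/ffunP => k.
  by have := eq1 k; have := eq2 k; rewrite !inE !ffunE; case: ifP.
rewrite -card_powerset -cardsX.
have -> : 2 ^ n = #|[set: config n]|.
  by rewrite cardsT card_ffun card_bool card_ord.
rewrite -(card_imset _ injh); apply/subset_leq_card/subsetP => _ /imsetP[y _ ->].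
rewrite !inE /=; apply/andP; split.
  by apply: subD => k kS; rewrite ffunE kS.
by apply/subsetP => k; rewrite inE => /andP[].
Qed.

(** [D] and its image under [flip] cover the cube. *)
Lemma edge_density n (D : {set config n}) (flip : config n -> config n) :
  involutive flip -> (forall x, (x \in D) || (flip x \in D)) ->
  2 ^ n <= #|D| * 2.
Proof.
move=> flipK cover.
have -> : 2 ^ n = #|D :|: flip @: D|.
  have -> : D :|: flip @: D = setT.
    apply/setP => x; rewrite !inE; case/orP: (cover x) => [->//|fxD].
    by rewrite -[x in x \in flip @: _]flipK imset_f ?orbT.
  by rewrite cardsT card_ffun card_bool card_ord.
rewrite muln2 -addnn (leq_trans (leq_card_setU _ _)) //.
by rewrite leq_add2l leq_imset_card.
Qed.

Lemma gray_code_degree n d (F : config n -> config n) :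
  is_gray_code F -> degree F <= d -> n <= 2 ^ d.
Proof.
move=> [[c [/andP[cycF _] _ allc]] diff1] degF.
pose D j := [set x : config n | F x j != x j].
pose S j := [set i | interaction F i j].
have leS j : #|S j| <= d by apply: leq_trans degF; apply: leq_bigmax.
have FS j (x y : config n) : {in S j, x =1 y} -> F x j = F y j.
  by move=> eqS; apply: interaction_eq => i ij; apply: eqS; rewrite inE.
(* Edges in direction [j] give only density 1/2, which is at least [2 ^ -d] once [d] is positive. *)
have d_gt0 : 0 < d.
  rewrite lt0n; apply/eqP => d0.
  pose x : config n := [ffun=> false].
  have fixF : F (F x) = F x.
    apply/ffunP => j; apply: FS => i.
    have /eqP := leS j; rewrite d0 subn0 => /eqP; rewrite cards_eq0 => /eqP ->.
    by rewrite inE.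
  have := diff1 (F x); rewrite fixF.
  suff -> : diff_set (F x) (F x) = set0 by rewrite cards0.
  by apply/setP => k; rewrite !inE eqxx.
have densD j : 2 ^ n <= #|D j| * 2 ^ d.
  have [jS|jNS] := boolP (j \in S j).
    have [x0 x0j] := gray_cycle_flips n F c j cycF allc.
    apply: leq_trans (subcube_density n (S j) (D j) x0 _) _.
      by move=> y eqS; rewrite inE (FS _ _ _ eqS) (eqS j jS).
    by rewrite leq_mul2l leq_exp2l ?leS ?orbT.
  pose flip (x : config n) : config n :=
    [ffun k => if k == j then ~~ x k else x k].
  apply: leq_trans (edge_density n (D j) flip _ _) _.
  - by move=> x; apply/ffunP => k; rewrite !ffunE; case: eqP; rewrite ?negbK.
  - move=> x; rewrite !inE.
    have -> : F (flip x) j = F x j.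
      apply: FS => k kS; rewrite ffunE; case: eqP => // kj.
      by rewrite kj (negbTE jNS) in kS.
    by rewrite ffunE eqxx; case: (F x j); case: (x j).
  - by rewrite leq_mul2l -{1}(expn1 2) leq_exp2l ?d_gt0 ?orbT.
(* Double counting of the pairs [(x, j)] such that [F] flips [j] at [x]: each [x] has exactly one
   such [j]. *)
have sumD : \sum_(j < n) #|D j| = 2 ^ n.
  transitivity (\sum_(x : config n) #|diff_set x (F x)|).
    under eq_bigr do rewrite -sum1dep_card.
    rewrite (exchange_big_dep xpredT) //=; apply: eq_bigr => x _.
    by rewrite -sum1dep_card; apply: eq_bigl => j; rewrite eq_sym.
  by rewrite (eq_bigr _ (fun x _ => diff1 x)) sum1_card card_ffun card_bool card_ord.
(* Scaled by [2 ^ n], the goal is the sum of the bounds [densD j] over the [n] components. *)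
rewrite -(leq_pmul2l (expn_gt0 2 n : 0 < 2 ^ n)) -{2}sumD big_distrl /=.
by rewrite mulnC -{1}(card_ord n) -sum_nat_const leq_sum.
Qed.

Theorem theorem6 (R : realType) (n d : nat) (hn : 1 <= n)
  (hF : exists F : config n -> config n, is_gray_code F /\ degree F <= d) :
  (log2 (n%:R : R) <= d%:R)%R.
Proof.
have [F [grayF degF]] := hF.
have ln2_gt0 : (0 < ln 2 :> R)%R by rewrite ln_gt0 // ltr1n.
rewrite /log2 ler_pdivrMr // mulr_natl -lnXn // -natrX.
rewrite ler_ln ?posrE ?ltr0n ?expn_gt0 // ler_nat.
exact: gray_code_degree grayF degF.
Qed.
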